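(* For integers $j\ge1$ let $A_j(x)=\frac{jx^2}{1-(j-1)x}$ and $B_j(x)=\frac{1+x}{1-(j-1)x}$. For $k\ge 1$ let $F_{11\text{-}1}(x;k)=\sum_{n\ge0}|[k]^n(11\text{-}1)|x^n$, where $[k]^n(11\text{-}1)$ is the set of words $\sigma=\sigma_1\cdots\sigma_n$ over $\{1,\dots,k\}$ for which there are no indices $i,j$ with $j>i+1$ and $\sigma_i=\sigma_{i+1}=\sigma_j$. Then for all $k\ge1$, $F_{11\text{-}1}(x;k)$ equals the determinant of the $k\times k$ matrix whose first column is $(B_k,B_{k-1},\dots,B_2,B_1+A_1)^T$, whose entries in positions $(r,r+1)$ are $-A_{k-r+1}$ for $r=1,\dots,k-1$, whose diagonal entries in positions $(r,r)$ for $r=2,\dots,k$ are $1$, and all of whose other entries are $0$ (all functions evaluated at $x$); equivalently, \[ F_{11\text{-}1}(x;k)=\prod_{i=1}^{k}A_i(x)+\sum_{j=1}^{k}B_j(x)\prod_{i=j+1}^{k}A_i(x). \]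
   Context: The empty word has length $0$; empty products equal $1$. *)

(* Defs.v *)
From HB Require Import structures.
From mathcomp Require Import all_boot all_order all_algebra.
From mathcomp Require Import boolp.

Set Implicit Arguments.
Unset Strict Implicit.
Unset Printing Implicit Defensive.

Import GRing.Theory.
Local Open Scope ring_scope.

(* The ring R[[x]] of formal power series, with the Cauchy product.  A series
   is wrapped in a record so that it does not inherit the pointwise product of
   nat -> R. *)

Record fps (R : Type) := Fps { fps_coef : nat -> R }.

Lemma fpsP (R : Type) (f g : fps R) :
  (forall n, fps_coef f n = fps_coef g n) -> f = g.
Proof. by case: f g => [f] [g] /= fg; congr Fps; exact: funext. Qed.

HB.instance Definition _ (R : Type) := gen_eqMixin (fps R).
HB.instance Definition _ (R : Type) := gen_choiceMixin (fps R).

Section Zmodule.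
Variable R : zmodType.

Definition fps_zero : fps R := Fps (fun=> 0).
Definition fps_opp (f : fps R) : fps R := Fps (fun n => - fps_coef f n).
Definition fps_add (f g : fps R) : fps R :=
  Fps (fun n => fps_coef f n + fps_coef g n).

Fact fps_addA : associative fps_add.
Proof. by move=> f g h; apply: fpsP => n /=; rewrite addrA. Qed.

Fact fps_addC : commutative fps_add.
Proof. by move=> f g; apply: fpsP => n /=; rewrite addrC. Qed.

Fact fps_add0 : left_id fps_zero fps_add.
Proof. by move=> f; apply: fpsP => n /=; rewrite add0r. Qed.

Fact fps_addN : left_inverse fps_zero fps_opp fps_add.
Proof. by move=> f; apply: fpsP => n /=; rewrite addNr. Qed.

HB.instance Definition _ :=
  GRing.isZmodule.Build (fps R) fps_addA fps_addC fps_add0 fps_addN.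

End Zmodule.

Section Ring.
Variable R : comNzRingType.

Definition fps_one : fps R := Fps (fun n => (n == 0%N)%:R).
Definition fps_mul (f g : fps R) : fps R :=
  Fps (fun n => \sum_(i < n.+1) fps_coef f i * fps_coef g (n - i)%N).

Let trunc N (f : fps R) : {poly R} := \poly_(i < N) fps_coef f i.

Let coef_trunc N f n : (n < N)%N -> (trunc N f)`_n = fps_coef f n.
Proof. by move=> nN; rewrite coef_poly nN. Qed.

Let coef_mul N f g n : (n < N)%N ->
  fps_coef (fps_mul f g) n = (trunc N f * trunc N g)`_n.
Proof.
move=> nN; rewrite coefM; apply: eq_bigr => i _.
rewrite !coef_trunc // ?(leq_ltn_trans (leq_subr _ _) nN) //.
by apply: leq_ltn_trans nN; rewrite -ltnS.
Qed.

Fact fps_mulA : associative fps_mul.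
Proof.
move=> f g h; apply: fpsP => n.
transitivity (trunc n.+1 f * (trunc n.+1 g * trunc n.+1 h))`_n.
  rewrite coefM; apply: eq_bigr => i _.
  by rewrite coef_trunc // (@coef_mul n.+1) // ltnS leq_subr.
rewrite mulrA coefM; apply: eq_bigr => i _.
by rewrite (@coef_mul n.+1) // coef_trunc // ltnS leq_subr.
Qed.

Fact fps_mulC : commutative fps_mul.
Proof. by move=> f g; apply: fpsP => n; rewrite !(@coef_mul n.+1) // mulrC. Qed.

Fact fps_mul1 : left_id fps_one fps_mul.
Proof.
move=> f; apply: fpsP => n /=.
rewrite big_ord_recl /= mul1r subn0 big1 ?addr0 // => i _.
by rewrite /= mul0r.
Qed.

Fact fps_mulD : left_distributive fps_mul +%R.
Proof.
move=> f g h; apply: fpsP => n /=.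
by rewrite -big_split /=; apply: eq_bigr => i _; rewrite mulrDl.
Qed.

Fact fps_one_neq0 : fps_one != 0.
Proof.
by apply/eqP => /(congr1 (fun f => fps_coef f 0)) /eqP; rewrite /= oner_eq0.
Qed.

HB.instance Definition _ := GRing.Zmodule_isComNzRing.Build (fps R)
  fps_mulA fps_mulC fps_mul1 fps_mulD fps_one_neq0.

End Ring.

Section UnitRing.
Variable R : comUnitRingType.

Definition fps_unit : pred (fps R) :=
  [pred f | fps_coef f 0 \is a GRing.unit].

(* The first n coefficients of 1/f when f(0) is a unit. *)
Fixpoint fps_inv_coefs (f : fps R) (n : nat) : seq R :=
  if n is m.+1 then
    let s := fps_inv_coefs f m in
    rcons s ((fps_coef f 0)^-1 *
             ((m == 0%N)%:R - \sum_(i < m) s`_i * fps_coef f (m - i)%N))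
  else [::].

Definition fps_inv (f : fps R) : fps R :=
  if fps_unit f then Fps (fun n => (fps_inv_coefs f n.+1)`_n) else f.

Let size_inv_coefs f n : size (fps_inv_coefs f n) = n.
Proof. by elim: n => //= n IHn; rewrite size_rcons IHn. Qed.

Let nth_inv_coefs f n i : (i < n)%N ->
  (fps_inv_coefs f n)`_i = (fps_inv_coefs f i.+1)`_i.
Proof.
elim: n => // n IHn; rewrite ltnS leq_eqVlt => /orP[/eqP -> //|lt_in].
by rewrite [LHS]/= nth_rcons size_inv_coefs lt_in IHn.
Qed.

Fact fps_mulVf : {in fps_unit, left_inverse 1 fps_inv *%R}.
Proof.
move=> f uf; have uf0 : fps_coef f 0 \is a GRing.unit by [].
apply: fpsP => n; rewrite /fps_inv ifT //.
rewrite [LHS]big_ord_recr subnn /= nth_rcons size_inv_coefs ltnn eqxx.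
rewrite mulrAC mulVr // mul1r addrC.
rewrite [X in _ + X](eq_bigr (fun i : 'I_n =>
  (fps_inv_coefs f n)`_i * fps_coef f (n - i)%N)) ?subrK // => i _.
by congr (_ * _); symmetry; exact: nth_inv_coefs.
Qed.

Fact fps_unitPl (f g : fps R) : g * f = 1 -> fps_unit f.
Proof.
move=> /(congr1 (fun h => fps_coef h 0)); rewrite /= big_ord1 => gf1.
by apply/unitrP; exists (fps_coef g 0); split=> //; rewrite mulrC.
Qed.

Fact fps_inv_out : {in [predC fps_unit], fps_inv =1 id}.
Proof. by move=> f uf; rewrite /fps_inv ifN. Qed.

HB.instance Definition _ := GRing.ComNzRing_hasMulInverse.Build (fps R)
  fps_mulVf fps_unitPl fps_inv_out.

End UnitRing.

Definition fpsX (R : nzRingType) : fps R := Fps (fun n => (n == 1%N)%:R).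

(* An occurrence of 11-1 in w = w_0 ... w_(n-1) is a pair of indices i, j with
   j > i + 1 and w_i = w_(i+1) = w_j; below i1 stands for i + 1.  The alphabet
   {1, ..., k} is represented by 'I_k. *)
Definition avoids_11_1 (k n : nat) (w : n.-tuple 'I_k) : bool :=
  ~~ [exists i : 'I_n, exists i1 : 'I_n, exists j : 'I_n,
        [&& i1 == i.+1 :> nat, (i.+1 < j)%N,
            tnth w i == tnth w i1 & tnth w i1 == tnth w j]].

Definition words_11_1 (k n : nat) : {set n.-tuple 'I_k} :=
  [set w | avoids_11_1 w].

Definition F_11_1 (k : nat) : fps rat := Fps (fun n => #|words_11_1 k n|%:R).

(* The denominators of A and B are units, so the quotients are genuine ones. *)
Fact denom_unit (j : nat) :
  1 - (j%:R - 1) * fpsX rat \is a @GRing.unit (fps rat).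
Proof.
have E : fps_coef (1 - (j%:R - 1) * fpsX rat) 0 = 1.
  by rewrite /= big_ord1 /= mulr0 subr0.
by change (fps_coef (1 - (j%:R - 1) * fpsX rat) 0 \is a GRing.unit);
  rewrite E unitr1.
Qed.

Definition A (j : nat) : fps rat :=
  j%:R * fpsX rat ^+ 2 / (1 - (j%:R - 1) * fpsX rat).

Definition B (j : nat) : fps rat :=
  (1 + fpsX rat) / (1 - (j%:R - 1) * fpsX rat).

(* Indices are 0-based: the entry (r, c) is the one in position (r+1, c+1) for
   indices starting at 1. *)
Definition M_11_1 (k : nat) : 'M[fps rat]_k :=
  \matrix_(r < k, c < k)
    if c == 0%N :> nat then
      if r == k.-1 :> nat then B 1 + A 1 else B (k - r)
    else if c == r then 1
    else if c == r.+1 :> nat then - A (k - r)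
    else 0.

(* Main.v *)
(** Let [S] be an alphabet with [k] letters, [F] the series counting the words
    over [S] that avoid 11-1, and, for a letter [l], let [G l] be the series
    counting the words [w] such that [l w] avoids 11-1.  Reading the next letter
    gives [F = 1 + x \sum_l G l] and
    [G l = 1 + x F' + x \sum_(a != l) G a], where [F'] is the series of the
    alphabet [S] without [l]: after [l l], the letter [l] is forbidden.  Summing
    over [l] eliminates the [G l] and yields [F_k = A_k F_(k-1) + B_k], with
    [F_0 = 1].  Expanding the determinant along its first row produces the same
    recurrence. *)
Require Import Defs.
From mathcomp Require Import all_boot all_order all_algebra.
From mathcomp Require Import ring.

Import GRing.Theory.
Local Open Scope ring_scope.

Lemma fps_coefD (R : comNzRingType) (f g : fps R) n :
  fps_coef (f + g) n = fps_coef f n + fps_coef g n.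
Proof. by []. Qed.

Lemma fps_coefXM (R : comNzRingType) (f : fps R) n :
  fps_coef (fpsX R * f) n = if n is m.+1 then fps_coef f m else 0.
Proof.
rewrite [LHS]/=; case: n => [|n]; first by rewrite big_ord1 /= mul0r.
rewrite big_ord_recl /= mul0r add0r big_ord_recl /= mul1r subn1 /=.
by rewrite big1 ?addr0 // => i _; rewrite mul0r.
Qed.

Lemma fps_coef_sum (R : comNzRingType) (I : Type) (r : seq I) (P : pred I)
    (F : I -> fps R) n :
  fps_coef (\sum_(i <- r | P i) F i) n = \sum_(i <- r | P i) fps_coef (F i) n.
Proof. by apply: (big_morph (fun f => fps_coef f n)). Qed.

Section Counting.
Variable T : finType.
Implicit Types (P Q : pred (seq T)) (S : {set T}) (s : seq T).

Definition count_words P n : nat := #|[set w : n.-tuple T | P w]|.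

Lemma eq_count_words P Q n : P =1 Q -> count_words P n = count_words Q n.
Proof. by move=> PQ; apply: eq_card => w; rewrite !inE PQ. Qed.

Lemma count_words_pred0 P n : P =1 pred0 -> count_words P n = 0%N.
Proof. by move=> P0; apply: eq_card0 => w; rewrite inE P0. Qed.

Lemma count_words0 P : count_words P 0 = P [::].
Proof.
rewrite /count_words; case: (boolP (P [::])) => P0.
  rewrite -[RHS](@cards1 _ ([tuple] : 0.-tuple T)); apply: eq_card => w.
  by rewrite !inE tuple0 P0 eqxx.
by apply: eq_card0 => w; rewrite inE tuple0 (negPf P0).
Qed.

Lemma count_wordsS P n :
  count_words P n.+1 = (\sum_a count_words (fun s => P (a :: s)) n)%N.
Proof.
rewrite /count_words -sum1_card.
rewrite (partition_big (fun w : n.+1.-tuple T => thead w) predT) //=.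
apply: eq_bigr => a _; rewrite sum1_card.
rewrite -(card_imset _ (f := fun w : n.-tuple T => [tuple of a :: w])); last first.
  by move=> u v /(congr1 val) [] /val_inj.
apply: eq_card => w; rewrite unfold_in /= inE.
apply/andP/imsetP => [[Pw /eqP <-]|[v]].
  exists [tuple of behead w]; last by rewrite -tuple_eta.
  by move: Pw; rewrite inE {1}(tuple_eta w).
by rewrite inE => Pv ->; rewrite theadE eqxx.
Qed.

(** Avoidance is phrased by recursion on the first letter, so that prepending a letter is mere
    computation; [avoidsP] ties it to positions. *)
Fixpoint avoids (s : seq T) : bool :=
  if s is a :: t then
    (if t is b :: u then (a == b) ==> (a \notin u) else true) && avoids t
  else true.

Lemma avoidsP x0 s :
  reflect (forall i j, (i.+1 < j)%N -> (j < size s)%N ->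
             nth x0 s i = nth x0 s i.+1 -> nth x0 s i.+1 <> nth x0 s j)
          (avoids s).
Proof.
elim: s => [|a t IHt]; first by apply: ReflectT => i [].
apply: (iffP andP) => [[at_ok /IHt t_ok] [|i] [|j] //|ok].
- case: t at_ok {IHt t_ok} => [|b u] //= at_ok.
  case: j => // j; rewrite !ltnS => _ ju ab; rewrite -ab /= => aj.
  by move: at_ok; rewrite ab eqxx /= -ab aj mem_nth.
- by rewrite /= !ltnS; exact: t_ok.
split; last by apply/IHt => i j ij jt; exact: (ok i.+1 j.+1).
case: t {IHt} ok => [|b u] //= ok; apply/implyP => /eqP ab.
(* A later copy of [a] found in [u] sits two places further in [a :: b :: u]. *)
apply/negP => au; apply: (ok 0 (index a u).+2) => //=.
- by rewrite !ltnS index_mem.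
- by rewrite nth_index.
Qed.

(** The alphabet is a subset of a fixed type, so that forbidding a letter does not change the type
    of words. *)
Definition avoids_in S : pred (seq T) := fun s => all (mem S) s && avoids s.

Definition gf_avoid S : fps rat := Fps (fun n => (count_words (avoids_in S) n)%:R).

Definition gf_after S l : fps rat :=
  Fps (fun n => (count_words (fun s => avoids_in S (l :: s)) n)%:R).

Lemma gf_avoid_rec S : gf_avoid S = 1 + fpsX rat * \sum_(l in S) gf_after S l.
Proof.
apply: fpsP => -[|n]; rewrite fps_coefD fps_coefXM.
  by rewrite /= count_words0 addr0.
rewrite fps_coef_sum /= add0r count_wordsS natr_sum [RHS]big_mkcond.
apply: eq_bigr => l _; case: ifPn => // lS.
by rewrite count_words_pred0 // => s; rewrite /avoids_in /= (negPf lS).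
Qed.

Lemma gf_after_rec S l : l \in S ->
  gf_after S l = 1 + fpsX rat * (gf_avoid (S :\ l) + \sum_(a in S :\ l) gf_after S a).
Proof.
move=> lS; apply: fpsP => -[|n]; rewrite fps_coefD fps_coefXM.
  by rewrite /= count_words0 /avoids_in /= lS addr0.
rewrite fps_coefD fps_coef_sum /= add0r count_wordsS natr_sum.
rewrite (bigD1 l) //=; congr (_ + _).
  congr _%:R; apply: eq_count_words => s; rewrite /avoids_in /= lS eqxx /=.
  have -> : all (mem (S :\ l)) s = all (mem S) s && (l \notin s).
    elim: s => //= a s ->; rewrite in_cons negb_or in_setD1 eq_sym.
    by case: (l == a); case: (a \in S); case: (all _ s).
  (* If [l] is absent from [s], the head of [s] differs from [l], so the second [l] imposes no
     further condition. *)
  case: s => [|b s] //=; rewrite in_cons negb_or.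
  by case: eqP => [<-|_]; case: (l \in s); rewrite ?andbF ?andbT /=.
rewrite big_mkcond [RHS]big_mkcond; apply: eq_bigr => a _; rewrite !inE.
case: eqVneq => //= al; case: ifPn => aS.
  congr _%:R; apply: eq_count_words => s; rewrite /avoids_in /= lS aS.
  by rewrite eq_sym (negPf al).
by rewrite count_words_pred0 // => s; rewrite /avoids_in /= (negPf aS) andbF.
Qed.

Lemma gf_avoid_set0 : gf_avoid set0 = 1.
Proof. by rewrite gf_avoid_rec big_set0 mulr0 addr0. Qed.

Lemma gf_avoid_recurrence S (f : fps rat) k : #|S| = k.+1 ->
  (forall l, l \in S -> gf_avoid (S :\ l) = f) -> gf_avoid S = A k.+1 * f + B k.+1.
Proof.
move=> cardS Ff; set x := fpsX rat; set G := \sum_(l in S) gf_after S l.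
have sumG : (1 - (k.+1%:R - 1) * x) * G = k.+1%:R * (1 + x * f).
  have -> : k.+1%:R * (1 + x * f) = \sum_(l in S) (1 + x * f).
    by rewrite sumr_const cardS mulr_natl.
  (* Adding [x * gf_after S l] to both sides of [gf_after_rec] completes its sum to [G], which is
     the same for every [l]. *)
  have -> : \sum_(l in S) (1 + x * f) = \sum_(l in S) ((1 + x) * gf_after S l - x * G).
    apply: eq_bigr => l lS; rewrite mulrDl mul1r {1}(gf_after_rec _ _ lS) (Ff _ lS).
    by rewrite /G (big_setD1 _ lS) /= -/x; ring.
  rewrite sumrB -mulr_sumr sumr_const cardS -/G -mulr_natl; ring.
have uD := denom_unit k.+1; rewrite -/x in uD.
apply: (mulrI uD); rewrite gf_avoid_rec -/x -/G /A /B -/x.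
(* The inverse becomes a variable [D] known only through [DK], leaving polynomial identities for
   [ring]. *)
move: (divrr uD); move: (1 - _)^-1 => D DK.
rewrite mulrDr mulrCA sumG.
transitivity ((1 - (k.+1%:R - 1) * x) * D * (k.+1%:R * x ^+ 2 * f + (1 + x)));
  last by ring.
by rewrite DK; ring.
Qed.

End Counting.

Arguments avoids {T} s.
Arguments avoids_in {T} S s.
Arguments gf_avoid {T} S.

Fixpoint F_formula (k : nat) : fps rat :=
  if k is m.+1 then A m.+1 * F_formula m + B m.+1 else 1.

(** By induction on the size over all subsets at once: all sets [S :\ l] then share one series, as
    [gf_avoid_recurrence] requires. *)
Lemma gf_avoid_formula (T : finType) (S : {set T}) : gf_avoid S = F_formula #|S|.
Proof.
move: {-1}#|S| (erefl #|S|) => k; elim: k S => [|k IHk] S cardS.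
  by rewrite (cards0_eq cardS) gf_avoid_set0.
apply: (@gf_avoid_recurrence _ _ _ _ cardS) => l lS; apply: IHk.
by move: cardS; rewrite (cardsD1 l) lS => -[].
Qed.

Lemma avoids_11_1E k n (w : n.-tuple 'I_k) : avoids_11_1 w = avoids w.
Proof.
(* The empty word is treated apart because [nth] needs a default letter, supplied by the head
   otherwise. *)
case: n w => [|n] w.
  by rewrite tuple0 /avoids_11_1; apply/existsP => -[[]].
have x0 := thead w; apply/idP/(avoidsP _ x0) => [ok i j ij|ok].
  rewrite size_tuple => jn wi wj; move/negP: ok; apply.
  have i1n := ltn_trans ij jn.
  apply/existsP; exists (Ordinal (ltnW i1n)).
  apply/existsP; exists (Ordinal i1n).
  apply/existsP; exists (Ordinal jn).
  by rewrite !(tnth_nth x0) /= wi wj ij !eqxx.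
apply/negP => /existsP[i /existsP[i1 /existsP[j /and4P[/eqP i1E ij]]]].
rewrite !(tnth_nth x0) i1E => /eqP wi /eqP wj.
by apply: (ok i j) => //; rewrite size_tuple.
Qed.

Lemma F_11_1_formula k : F_11_1 k = F_formula k.
Proof.
rewrite -[in RHS](card_ord k) -cardsT -gf_avoid_formula; apply: fpsP => n /=.
congr _%:R; apply: eq_card => w; rewrite !inE avoids_11_1E /avoids_in.
suff -> : all (mem [set: 'I_k]) w by [].
by apply/allP => a _; rewrite inE.
Qed.

(** Multiplying by [A k.+1] lengthens every product by one factor, and [B k.+1] enters as the
    summand with an empty product. *)
Lemma F_formula_sum k :
  F_formula k = \prod_(1 <= i < k.+1) A i
             + \sum_(1 <= j < k.+1) B j * \prod_(j.+1 <= i < k.+1) A i.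
Proof.
elim: k => [|k IHk]; first by rewrite !big_geq // addr0.
rewrite /= IHk [X in _ = X + _]big_nat_recr // [X in _ = _ + X]big_nat_recr //=.
rewrite [\prod_(k.+2 <= i < k.+2) _]big_geq // mulr1.
rewrite mulrDr addrA mulrC; congr (_ + _ + _).
rewrite mulr_sumr; apply: eq_big_nat => j /andP[_ jk].
by rewrite [in RHS]big_nat_recr //= mulrCA [A _ * _]mulrC.
Qed.

Lemma F_formula_det k : F_formula k.+1 = \det (M_11_1 k.+1).
Proof.
elim: k => [|k IHk].
  by rewrite det_mx11 mxE /= mulr1 addrC.
(* Only the first two entries of the top row can be nonzero; the cofactor sign turns [- A k.+2] into
   [A k.+2]. *)
rewrite (expand_det_row _ ord0) !big_ord_recl big1 ?addr0; last first.
  by move=> i _; rewrite mxE /= mul0r.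
rewrite !mxE /= subn0 /cofactor.
rewrite /= expr0 mul1r expr1 mulN1r mulrNN.
have -> : \det (row' ord0 (col' ord0 (M_11_1 k.+2))) = 1.
  (* This minor is upper triangular with unit diagonal; [det_trig] wants lower triangular, hence the
     transpose. *)
  rewrite -det_tr det_trig; last first.
    apply/is_trig_mxP => i j ij; rewrite !mxE -!(inj_eq val_inj) /=.
    by rewrite /bump !leq0n !add1n !eqSS !ltn_eqF // leqW.
  by rewrite big1 // => i _; rewrite !mxE /= eqxx.
(* The first column survives, and [k - r] is unchanged when size and row index both drop by one. *)
have -> : row' ord0 (col' (lift ord0 ord0) (M_11_1 k.+2)) = M_11_1 k.+1.
  apply/matrixP => i j; rewrite !mxE -!(inj_eq val_inj) /= /bump !leq0n !add1n.
  by case: (nat_of_ord j) => [|m]; rewrite ?eqSS //= !add1n !eqSS.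
by rewrite mulr1 addrC -[_ * _ + _]/(F_formula k.+1) IHk.
Qed.

Theorem theorem3p1 (k : nat) (hk : (1 <= k)%N) :
  F_11_1 k = \det (M_11_1 k) /\
  F_11_1 k = \prod_(1 <= i < k.+1) A i
             + \sum_(1 <= j < k.+1) B j * \prod_(j.+1 <= i < k.+1) A i.
Proof.
rewrite F_11_1_formula; split; last exact: F_formula_sum.
by case: k hk => // k _; exact: F_formula_det.
Qed.
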